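(* Let $\alpha,\nu_1,\nu_2,D,\kappa_{CP},\kappa_{SP},\zeta>0$, $0<\hat N\le N$ and $\kappa_{CP}\zeta>e$. Fix an epoch $t$ with demand $d_t\ge0$. Let $u_{SP,0}=\nu_2D\log\left(\kappa_{SP}\frac ND\right)$ and $$P^*=\left\{\frac{\alpha d_t}{\hat N},\ \frac{\alpha\log(\kappa_{CP}\zeta)}{\zeta},\ \alpha\,\frac{\nu_1d_t+\nu_2D}{\nu_1N}\right\},$$ where the third element is admitted as a candidate only if $\frac{\alpha d_t}{\hat N}\le \alpha\frac{\nu_1d_t+\nu_2D}{\nu_1N}\le\frac{\alpha}{\zeta}$ (this is a necessary condition for that candidate to be optimal). Then the optimal strategy $(p_t^*,y_t^* )$ of the short-sighted SP, anticipating the CP's best response, is as follows. (i) If $0<d_t\le\hat N/\zeta$, the optimal price is $p_t^*\in\operatorname{argmax}\{u_{SP,t}(p_t):p_t\in P^*\}$, with $y_t^*=1$ if $u_{SP,t}(p_t^* )\ge u_{SP,0}$, while $(p_t^*,y_t^* )=(-,0)$ if $u_{SP,t}(p_t^* )<u_{SP,0}$. (ii) If $d_t>\hat N/\zeta$ or $d_t=0$, then $(p_t^*,y_t^* )=(-,0)$. Here ''$-$'' means that no price is quoted.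
   Context: Two-stage game at epoch $t$ between a service provider (SP, leader) and a content provider (CP, follower), given demand $d_t\ge0$. Convention: $\log 0=-\infty$. Stage 2 (CP). Given the price $p_t\in\mathbb R$ per sponsored bit, the CP solves $\max_{b_t>0}u_{CP,t}(b_t)$ subject to $b_t/d_t\ge\zeta$ and $b_t\le\hat N$, where $u_{CP,t}(b_t)=\alpha d_t\log(\kappa_{CP}b_t/d_t)-p_tb_t$ if $d_t>0$ and $u_{CP,t}(b_t)=-p_tb_t$ if $d_t=0$. She exits ($z_t=0$) if $d_t=0$, the problem is infeasible, or the optimal value is negative; otherwise she joins ($z_t=1$; an indifferent CP joins) and sponsors the maximizer $b_t^*=b_t^*(p_t)$ bits. Stage 1 (SP). If the CP joins with $b_t^*=b_t^*(p_t)$ the SP's utility is $$u_{SP,t}(p_t)=p_tb_t^*+\nu_1d_t\log\left(\frac{\kappa_{SP}b_t^*}{d_t}\right)+\nu_2D\log\left(\kappa_{SP}\frac{N-b_t^*}{D}\right).$$ The SP maximizes $u_{SP,t}(p_t)$ over the prices $p_t$ for which the CP joins. Let $u^*_{SP,t}$ be the optimal value. The SP does not offer the program ($y_t=0$) if $u^*_{SP,t}<u_{SP,0}$ (the no-sponsoring utility), if $d_t=0$, or if no price makes the CP join; otherwise she offers it ($y_t=1$) at a maximizing price. *)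

(* Defs.v *)
From mathcomp Require Import all_boot all_order all_algebra.
From mathcomp Require Import all_classical all_reals all_analysis.

Set Implicit Arguments.
Unset Strict Implicit.
Unset Printing Implicit Defensive.

Import Order.TTheory GRing.Theory Num.Theory.

Local Open Scope classical_set_scope.
Local Open Scope ring_scope.

Definition argmax (R : realType) (T : Type) (A : set T) (f : T -> \bar R)
  : set T := [set x | A x /\ forall y, A y -> (f y <= f x)%E].

Record params (R : realType) := Params {
  alpha : R; nu1 : R; nu2 : R; D : R;
  kCP : R; kSP : R; zeta : R;
  Nhat : R; N : R }.

Section Game.
Variables (R : realType) (g : params R) (d : R).
(* [d] is the demand d_t of the fixed epoch.  Utilities are extended reals,
   since [lne 0 = -oo]. *)

Definition u_CP (p b : R) : \bar R :=
  if d == 0 then (- (p * b))%:E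
  else ((alpha g * d)%:E * lne (kCP g * b / d)%:E - (p * b)%:E)%E.

(* For d = 0 the quotient [b / d] is the junk value 0; the CP then exits
   whatever the constraint says, see [CP_joins]. *)
Definition CP_feasible : set R :=
  [set b | [/\ 0 < b, zeta g <= b / d & b <= Nhat g]].

Definition CP_value (p : R) : \bar R := ereal_sup (u_CP p @` CP_feasible).

Definition CP_joins (p : R) : Prop :=
  ~ (d = 0 \/ CP_feasible = set0 \/ (CP_value p < 0)%E).

(* b_t^*(p): the maximizer exists and is unique as soon as the feasible set is
   nonempty, the parameters and d being positive; the default value 0 is
   therefore never used at a price that makes the CP join. *)
Definition b_star (p : R) : R := xget 0 (argmax CP_feasible (u_CP p)).

Definition u_SP (p : R) : \bar R :=
  let b := b_star p in
  ((p * b)%:E + (nu1 g * d)%:E * lne (kSP g * b / d)%:E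
   + (nu2 g * D g)%:E * lne (kSP g * ((N g - b) / D g))%:E)%E.

Definition u_SP0 : \bar R :=
  ((nu2 g * D g)%:E * lne (kSP g * (N g / D g))%:E)%E.

Definition joining_prices : set R := [set p | CP_joins p].

Definition SP_value : \bar R := ereal_sup (u_SP @` joining_prices).

Definition SP_no_offer : Prop :=
  (SP_value < u_SP0)%E \/ d = 0 \/ joining_prices = set0.

(* A strategy is a pair (p_t, y_t), with [None] when no price is quoted. *)
Definition SP_optimal (s : option R * bool) : Prop :=
  (SP_no_offer /\ s = (None, false)) \/
  (~ SP_no_offer /\
   exists2 p, argmax joining_prices u_SP p & s = (Some p, true)).

Definition price_at_Nhat : R := alpha g * d / Nhat g.
Definition price_at_zeta : R := alpha g * ln (kCP g * zeta g) / zeta g.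
Definition price_interior : R :=
  alpha g * ((nu1 g * d + nu2 g * D g) / (nu1 g * N g)).

Definition candidate_prices : set R :=
  [set price_at_Nhat; price_at_zeta] `|`
  [set p | p = price_interior /\
           price_at_Nhat <= price_interior <= alpha g / zeta g].

End Game.

(* Main.v *)
(* A CP facing the price p sponsors the clamp of (alpha d)/p to [d zeta, Nhat] (Nhat if p <= 0),
   and joins iff p <= price_at_zeta, because alpha/zeta < price_at_zeta.  Where
   the clamp is active the SP's utility strictly increases with p (unless it is
   -oo); in between, p b is constant and the remaining terms are strictly concave
   in b, with critical point (alpha d)/price_interior.  Hence every joining price
   that is not a candidate is strictly worse than some candidate, or has utility
   -oo, in which case it is worse than not offering.  Strict concavity enters
   only through the tangent bound ln y < ln x + (y - x)/x. *)
Require Import Defs.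
From mathcomp Require Import all_boot all_order all_algebra.
From mathcomp Require Import all_classical all_reals all_analysis.
From mathcomp Require Import ring lra.

Set Implicit Arguments.
Unset Strict Implicit.

Import Order.TTheory GRing.Theory Num.Theory.
Local Open Scope classical_set_scope.
Local Open Scope ring_scope.

(** * Logarithm tangents and maxima over finite sets *)

Lemma ln_lt_tangent (R : realType) (k x y : R) :
  0 < k -> 0 < x -> 0 < y -> y != x -> ln (k * y) < ln (k * x) + (y - x) / x.
Proof.
move=> k0 x0 y0 yx.
have yx0 : 0 < y / x by rewrite divr_gt0.
have lnyx : ln (y / x) != 0.
  by rewrite ln_eq0//; apply: contra yx => /eqP/divr1_eq ->.
(* Strictness comes from [1 + z < expR z] at [z = ln (y / x)], nonzero because [y != x]. *)
have := expR_gt1Dx lnyx; rewrite lnK ?posrE// => lnlt.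
have -> : ln (k * y) = ln (k * x) + ln (y / x).
  rewrite -lnM ?posrE ?(mulr_gt0 k0)//; congr (ln _).
  by field; rewrite gt_eqF.
by rewrite ltrD2l mulrBl divff ?gt_eqF// ltrBrDl.
Qed.

Lemma argmax_finite (R : realType) (T : eqType) (A : set T) (f : T -> \bar R) :
  finite_set A -> A !=set0 -> argmax A f !=set0.
Proof.
move=> /finite_seqP[s ->]; elim: s => [[x]//|a [|b s] ih _].
  exists a; split => /= [|y]; first exact: mem_head.
  by rewrite inE => /eqP ->.
have [|m [/= ms mmax]] := ih; first by exists b => /=; exact: mem_head.
have [fam|/ltW fma] := leP (f a) (f m).
  exists m; split => /= [|y]; first by rewrite inE ms orbT.
  by rewrite inE => /orP[/eqP ->//|/mmax].
exists a; split => /= [|y]; first exact: mem_head.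
by rewrite inE => /orP[/eqP ->//|/mmax/le_trans]; apply.
Qed.

(** * The CP's best response *)

Section Game.
Variables (R : realType) (g : params R) (d : R).
Hypotheses (alpha_gt0 : 0 < alpha g) (nu1_gt0 : 0 < nu1 g)
  (nu2_gt0 : 0 < nu2 g) (D_gt0 : 0 < D g) (kCP_gt0 : 0 < kCP g)
  (kSP_gt0 : 0 < kSP g) (zeta_gt0 : 0 < zeta g) (Nhat_gt0 : 0 < Nhat g)
  (Nhat_le : Nhat g <= N g) (kz_gt : expR 1 < kCP g * zeta g)
  (d_gt0 : 0 < d).

Let N_gt0 : 0 < N g. Proof. exact: lt_le_trans Nhat_le. Qed.
Let dz_gt0 : 0 < d * zeta g. Proof. exact: mulr_gt0. Qed.

Lemma CP_feasibleE b :
  CP_feasible g d b <-> d * zeta g <= b <= Nhat g.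
Proof.
split=> [[b0 zb ->]|/andP[zb bN]].
  by rewrite andbT mulrC -ler_pdivlMr.
split => //; first exact: lt_le_trans zb.
by rewrite ler_pdivlMr// mulrC.
Qed.

Lemma u_CPE p b : 0 < b ->
  u_CP g d p b = (alpha g * d * ln (kCP g * b / d) - p * b)%:E.
Proof.
by move=> b0; rewrite /u_CP gt_eqF// lne_EFin// divr_gt0// mulr_gt0.
Qed.

(* The last hypothesis: the tangent to the strictly concave [u_CP p] at [b0]
   is nonincreasing from [b0] towards [b]. *)
Lemma u_CP_lt (p b b0 : R) : 0 < b -> 0 < b0 -> b != b0 ->
  (b - b0) * (alpha g * d / b0 - p) <= 0 -> (u_CP g d p b < u_CP g d p b0)%E.
Proof.
move=> b_gt0 b0_gt0 bb0 le0; rewrite !u_CPE// lte_fin.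
have ad0 : 0 < alpha g * d by rewrite mulr_gt0.
have lt1 := ln_lt_tangent (divr_gt0 kCP_gt0 d_gt0) b0_gt0 b_gt0 bb0.
rewrite ![kCP g / d * _]mulrAC -(ltr_pM2l ad0) mulrDr in lt1.
have e : alpha g * d * ((b - b0) / b0) = (b - b0) * (alpha g * d / b0).
  by rewrite mulrCA mulrA.
by rewrite e in lt1; lra.
Qed.

(** First-order condition for a concave maximum: [alpha g * d / b0 - p] is the slope of [u_CP] at
    [b0]. Strictness in [u_CP_lt] gives uniqueness, so [xget] can only return [b0]. *)
Lemma b_starE (p b0 : R) : CP_feasible g d b0 ->
  (forall b, CP_feasible g d b -> (b - b0) * (alpha g * d / b0 - p) <= 0) ->
  b_star g d p = b0.
Proof.
move=> fb0 le0.
have lt b : CP_feasible g d b -> b != b0 -> (u_CP g d p b < u_CP g d p b0)%E.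
  move=> fb bb0; have [b_gt0 _ _] := fb; have [b0_gt0 _ _] := fb0.
  exact: u_CP_lt (le0 _ fb).
apply: xget_unique => [|b [fb bmax]].
  split=> // b fb; have [->//|bb0] := eqVneq b b0.
  exact/ltW/lt.
have [//|bb0] := eqVneq b b0.
by have := lt b fb bb0; rewrite ltNge bmax.
Qed.

Hypothesis dz_le : d * zeta g <= Nhat g.

Lemma feasible_min : CP_feasible g d (d * zeta g).
Proof. by apply/CP_feasibleE; rewrite lexx. Qed.

(** The slope at [Nhat g] is [price_at_Nhat g d - p], still nonnegative, so the cap binds. *)
Lemma b_star_Nhat p : p <= price_at_Nhat g d -> b_star g d p = Nhat g.
Proof.
move=> pN; apply: b_starE => [|b /CP_feasibleE /andP[_ bN]].
  by apply/CP_feasibleE; rewrite dz_le lexx.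
by rewrite mulr_le0_ge0 ?subr_ge0 ?subr_le0.
Qed.

Lemma b_star_min p : alpha g / zeta g <= p -> b_star g d p = d * zeta g.
Proof.
move=> pz; apply: b_starE => [|b /CP_feasibleE /andP[zb _]].
  exact: feasible_min.
rewrite mulr_ge0_le0 ?subr_ge0 ?subr_le0//.
have -> // : alpha g * d / (d * zeta g) = alpha g / zeta g.
by field; rewrite !gt_eqF.
Qed.

(** Rewriting backwards with this and [inv_price_min] turns bounds on the sponsored bits into bounds
    on the price. *)
Lemma inv_price_Nhat : alpha g * d / price_at_Nhat g d = Nhat g.
Proof. by rewrite /price_at_Nhat; field; rewrite !gt_eqF. Qed.

Lemma inv_price_min : alpha g * d / (alpha g / zeta g) = d * zeta g.
Proof. by field; rewrite !gt_eqF. Qed.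

Lemma b_star_interior p : price_at_Nhat g d <= p <= alpha g / zeta g ->
  b_star g d p = alpha g * d / p.
Proof.
move=> /andP[Np pz].
have pN0 : 0 < price_at_Nhat g d by rewrite divr_gt0// mulr_gt0.
have p0 : 0 < p := lt_le_trans pN0 Np.
have ad0 : 0 < alpha g * d by rewrite mulr_gt0.
apply: b_starE => [|b _].
  apply/CP_feasibleE; rewrite -inv_price_min -inv_price_Nhat.
  by rewrite !ler_pM2l// !lef_pV2 ?posrE ?divr_gt0// pz.
have -> : alpha g * d / (alpha g * d / p) = p.
  by field; rewrite !gt_eqF.
by rewrite subrr mulr0.
Qed.

(** * The CP's participation threshold *)

Lemma price_zeta_gt : alpha g / zeta g < price_at_zeta g.
Proof.
rewrite /price_at_zeta ltr_pM2r ?invr_gt0// -[ltLHS]mulr1 ltr_pM2l//.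
(* What remains is [1 < ln (kCP g * zeta g)], which is [kz_gt]. *)
by rewrite -ltr_expR lnK// posrE mulr_gt0.
Qed.

Lemma price_Nhat_le : price_at_Nhat g d <= alpha g / zeta g.
Proof.
rewrite /price_at_Nhat ler_pdivrMr// mulrAC ler_pdivlMr// -mulrA ler_pM2l//.
Qed.

Lemma u_CP_min p : u_CP g d p (d * zeta g) =
  (d * zeta g * (price_at_zeta g - p))%:E.
Proof.
rewrite u_CPE// /price_at_zeta; congr EFin.
have -> : kCP g * (d * zeta g) / d = kCP g * zeta g by field; rewrite gt_eqF.
by field; rewrite gt_eqF.
Qed.

(** Above the threshold the price also exceeds [alpha g / zeta g], so the minimum [d * zeta g] is
    the best choice, and its utility is negative by [u_CP_min]. Below it, the same choice already
    secures a nonnegative value. *)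
Lemma CP_joinsE p : CP_joins g d p <-> p <= price_at_zeta g.
Proof.
split=> [join|pz [d0|[f0|]]].
- rewrite leNgt; apply/negP => pz; apply: join; right; right.
  apply: (@le_lt_trans _ _ (u_CP g d p (d * zeta g))); last first.
    by rewrite u_CP_min lte_fin pmulr_rlt0// subr_lt0.
  apply: ge_ereal_sup => _ [b fb <-].
  have [->//|bz] := eqVneq b (d * zeta g).
  have [b_gt0 _ _] := fb.
  apply/ltW/u_CP_lt => //.
  move/CP_feasibleE: fb => /andP[zb _].
  rewrite mulr_ge0_le0 ?subr_ge0 ?subr_le0//.
  have -> : alpha g * d / (d * zeta g) = alpha g / zeta g.
    by field; rewrite !gt_eqF.
  exact/ltW/(lt_trans price_zeta_gt).
- by move: d_gt0; rewrite d0 ltxx.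
- by move: feasible_min; rewrite f0.
- rewrite ltNge => /negP; apply.
  apply: (@le_trans _ _ (u_CP g d p (d * zeta g))).
    by rewrite u_CP_min lee_fin mulr_ge0 ?subr_ge0// ltW.
  by apply: ereal_sup_ubound; exists (d * zeta g) => //; exact: feasible_min.
Qed.

Lemma candidate_joins p : candidate_prices g d p -> CP_joins g d p.
Proof.
move=> cp; apply/CP_joinsE.
case: cp => [[->|->]//|[-> /andP[_ le]]]; apply: ltW.
- exact: le_lt_trans price_Nhat_le price_zeta_gt.
- exact: le_lt_trans le price_zeta_gt.
Qed.

Lemma candidate_Nhat : candidate_prices g d (price_at_Nhat g d).
Proof. by left; left. Qed.

Lemma candidate_zeta : candidate_prices g d (price_at_zeta g).
Proof. by left; right. Qed.

Lemma argmax_candidates : argmax (candidate_prices g d) (u_SP g d) !=set0.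
Proof.
apply: argmax_finite; last by exists (price_at_zeta g); exact: candidate_zeta.
rewrite /candidate_prices !finite_setU; split; first by split; exact: finite_set1.
by apply: (@sub_finite_set _ _ [set price_interior g d]) => // p [].
Qed.

(** * The SP's utility as a function of the sponsored bits *)

Let traffic (b : R) : R := nu1 g * d * ln (kSP g * b / d)
  + nu2 g * D g * ln (kSP g * ((N g - b) / D g)).

Lemma u_SPE p b : b_star g d p = b -> 0 < b < N g ->
  u_SP g d p = (p * b + traffic b)%:E.
Proof.
move=> bE /andP[b0 bN]; rewrite /u_SP bE.
rewrite !lne_EFin; first by rewrite -!EFinM -!EFinD addrA.
  by rewrite mulr_gt0// divr_gt0// subr_gt0.
by rewrite divr_gt0// mulr_gt0.
Qed.

(** Covers the degenerate case [Nhat g = N g], where sponsoring may exhaust the capacity and the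
    last logarithm is [lne 0]. *)
Lemma u_SPNy p : 0 < b_star g d p -> b_star g d p = N g -> u_SP g d p = -oo%E.
Proof.
move=> b0 bN; rewrite /u_SP bN subrr mul0r mulr0 [lne 0%:E]le0_lneNy//.
rewrite lne_EFin; last by rewrite divr_gt0// mulr_gt0.
by rewrite gt0_muleNy ?lte_fin ?mulr_gt0// addeNy.
Qed.

(** Both logarithms lie below their tangents at [b0]. The last hypothesis is the sign condition on
    the summed tangent increments, cleared of the positive denominator [b0 * (N g - b0)]. *)
Lemma traffic_lt (b b0 : R) : 0 < b < N g -> 0 < b0 < N g -> b != b0 ->
  (b - b0) * (nu1 g * d * (N g - b0) - nu2 g * D g * b0) <= 0 ->
  traffic b < traffic b0.
Proof.
move=> /andP[b_gt0 bN] /andP[b0_gt0 b0N] bb0 le0.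
have nd0 : 0 < nu1 g * d by rewrite mulr_gt0.
have nD0 : 0 < nu2 g * D g by rewrite mulr_gt0.
have Nb0 : 0 < N g - b0 by rewrite subr_gt0.
have Nb : 0 < N g - b by rewrite subr_gt0.
have Nbb0 : N g - b != N g - b0.
  by apply: contra bb0 => /eqP /addrI /oppr_inj ->.
have lt1 := ln_lt_tangent (divr_gt0 kSP_gt0 d_gt0) b0_gt0 b_gt0 bb0.
rewrite ![kSP g / d * _]mulrAC -(ltr_pM2l nd0) mulrDr in lt1.
have lt2 := ln_lt_tangent (divr_gt0 kSP_gt0 D_gt0) Nb0 Nb Nbb0.
rewrite -![kSP g / D g * _]mulrA ![(D g)^-1 * _]mulrC -(ltr_pM2l nD0) mulrDr in lt2.
have e : nu1 g * d * ((b - b0) / b0)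
    + nu2 g * D g * ((N g - b - (N g - b0)) / (N g - b0)) =
    (b - b0) * (nu1 g * d * (N g - b0) - nu2 g * D g * b0) / (b0 * (N g - b0)).
  by field; rewrite !gt_eqF.
have : (b - b0) * (nu1 g * d * (N g - b0) - nu2 g * D g * b0)
    / (b0 * (N g - b0)) <= 0.
  by rewrite mulr_le0_ge0// invr_ge0 mulr_ge0// ltW.
rewrite -e /traffic; lra.
Qed.

(** * Comparison of joining prices with the candidates *)

Let dominated p := exists2 q, candidate_prices g d q & (u_SP g d p < u_SP g d q)%E.

(** The CP sponsors [Nhat g] all the way up to [price_at_Nhat g d], so raising the price to that
    point only adds revenue. *)
Lemma dominated_low p : p < price_at_Nhat g d ->
  u_SP g d p = -oo%E \/ dominated p.
Proof.
move=> pN; have bp := b_star_Nhat (ltW pN).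
move: (Nhat_le); rewrite le_eqVlt => /orP[/eqP NN|NN].
  by left; apply: u_SPNy; rewrite bp.
right; exists (price_at_Nhat g d); first exact: candidate_Nhat.
rewrite (u_SPE bp) ?Nhat_gt0// (u_SPE (b_star_Nhat (lexx _))) ?Nhat_gt0//.
by rewrite lte_fin ltrD2r ltr_pM2r.
Qed.

Lemma dominated_high p : alpha g / zeta g <= p < price_at_zeta g ->
  u_SP g d p = -oo%E \/ dominated p.
Proof.
move=> /andP[zp pz]; have bp := b_star_min zp.
move: (le_trans dz_le Nhat_le); rewrite le_eqVlt => /orP[/eqP NN|NN].
  by left; apply: u_SPNy; rewrite bp.
right; exists (price_at_zeta g); first exact: candidate_zeta.
rewrite (u_SPE bp) ?dz_gt0// (u_SPE (b_star_min (ltW price_zeta_gt))) ?dz_gt0//.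
by rewrite lte_fin ltrD2r ltr_pM2r.
Qed.

Lemma dominated_interior p : price_at_Nhat g d < p < alpha g / zeta g ->
  p = price_interior g d \/ dominated p.
Proof.
move=> /andP[Np pz].
have ad0 : 0 < alpha g * d by rewrite mulr_gt0.
have nd0 : 0 < nu1 g * d by rewrite mulr_gt0.
have nD0 : 0 < nu2 g * D g by rewrite mulr_gt0.
have pN0 : 0 < price_at_Nhat g d by rewrite divr_gt0.
have p0 : 0 < p := lt_trans pN0 Np.
have bp : b_star g d p = alpha g * d / p by rewrite b_star_interior// !ltW.
have bNhat : alpha g * d / p < Nhat g.
  by rewrite -inv_price_Nhat ltr_pM2l// ltf_pV2 ?posrE.
have bz : d * zeta g < alpha g * d / p.
  by rewrite -inv_price_min ltr_pM2l// ltf_pV2 ?posrE ?divr_gt0.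
have b_in : 0 < alpha g * d / p < N g.
  by rewrite divr_gt0//= (lt_le_trans bNhat).
have pb : p * (alpha g * d / p) = alpha g * d by field; rewrite gt_eqF.
set b := alpha g * d / p in bp bNhat bz b_in pb.
(* [b0] is the critical point of [traffic], the root of [nu1 g * d * (N g - b0) = nu2 g * D g * b0];
   the cases below locate it relative to [d * zeta g] and [Nhat g]. *)
set b0 := nu1 g * d * N g / (nu1 g * d + nu2 g * D g).
have s0 : 0 < nu1 g * d + nu2 g * D g by rewrite addr_gt0.
have intE : price_interior g d = alpha g * d / b0.
  by rewrite /price_interior /b0; field; rewrite !gt_eqF.
have b0_gt0 : 0 < b0 by rewrite divr_gt0// mulr_gt0.
have b0N : b0 < N g by rewrite ltr_pdivrMr// mulrC ltr_pM2l// ltrDl.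
have slope c : nu1 g * d * (N g - c) - nu2 g * D g * c =
    (nu1 g * d + nu2 g * D g) * (b0 - c).
  by rewrite /b0; field; rewrite gt_eqF.
(* Peak above the cap: [price_at_Nhat] keeps the revenue [alpha g * d] and moves the bits towards
   the peak. *)
have [ltN|geN] := ltP (Nhat g) b0.
  right; exists (price_at_Nhat g d); first exact: candidate_Nhat.
  have Nhat_in : 0 < Nhat g < N g by rewrite Nhat_gt0 (lt_trans ltN).
  rewrite (u_SPE bp)// (u_SPE (b_star_Nhat (lexx _)))//.
  rewrite lte_fin pb divfK ?gt_eqF// ltrD2l traffic_lt ?lt_eqF//.
  by rewrite slope mulr_le0_ge0 ?mulr_ge0 ?subr_ge0 ?subr_le0// ltW.
(* Peak below the minimum: moving the bits down to [d * zeta g] improves [traffic], and charging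
   [price_at_zeta] there earns more than [alpha g * d]. *)
have [ltz|gez] := ltP b0 (d * zeta g).
  right; exists (price_at_zeta g); first exact: candidate_zeta.
  have dz_in : 0 < d * zeta g < N g.
    by rewrite dz_gt0 (lt_le_trans bz)// ltW//; case/andP: b_in.
  rewrite (u_SPE bp)// (u_SPE (b_star_min (ltW price_zeta_gt)))//.
  rewrite lte_fin pb; apply: ltrD.
    have -> : alpha g * d = alpha g / zeta g * (d * zeta g).
      by field; rewrite gt_eqF.
    by rewrite ltr_pM2r// price_zeta_gt.
  rewrite traffic_lt ?gt_eqF// slope mulr_ge0_le0 ?subr_ge0 1?ltW//.
  by rewrite pmulr_rlt0// subr_lt0.
(* Peak within the feasible range: this is exactly the admission condition of the third
   candidate. *)
have int_in : price_at_Nhat g d <= price_interior g d <= alpha g / zeta g.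
  rewrite intE /price_at_Nhat ler_pM2l// lef_pV2 ?posrE// geN /=.
  by rewrite ler_pdivrMr// mulrAC ler_pdivlMr// -mulrA ler_pM2l.
have bint : b_star g d (price_interior g d) = b0.
  by rewrite b_star_interior// intE; field; rewrite !gt_eqF.
have [bb0|bb0] := eqVneq b b0.
  by left; rewrite intE -bb0 /b; field; rewrite !gt_eqF.
right; exists (price_interior g d); first by right.
rewrite (u_SPE bp)// (u_SPE bint) ?b0_gt0// lte_fin pb intE divfK ?gt_eqF//.
by rewrite ltrD2l traffic_lt ?b0_gt0// slope subrr mulr0 mulr0.
Qed.

Lemma joining_dominated p : CP_joins g d p ->
  [\/ u_SP g d p = -oo%E, candidate_prices g d p | dominated p].
Proof.
move=> /CP_joinsE; rewrite le_eqVlt => /orP[/eqP ->|pz].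
  by constructor 2; exact: candidate_zeta.
have [pN|Np|->] := ltgtP p (price_at_Nhat g d).
- by case: (dominated_low pN) => ?; [constructor 1|constructor 3].
- have [zp|pz'] := leP (alpha g / zeta g) p.
    by case: (@dominated_high p) => [|?|?];
      [rewrite zp|constructor 1|constructor 3].
  case: (@dominated_interior p) => [|pE|?]; [by rewrite Np| |by constructor 3].
  by constructor 2; right; split=> //=; rewrite -pE !ltW.
- by constructor 2; exact: candidate_Nhat.
Qed.

(** * The SP's optimal strategy *)

Lemma argmax_joining p : argmax (candidate_prices g d) (u_SP g d) p ->
  argmax (joining_prices g d) (u_SP g d) p.
Proof.
move=> [cp pmax]; split; first exact: candidate_joins.
move=> q /joining_dominated[->|/pmax//|[r cr qr]]; first exact: leNye.
exact: le_trans (ltW qr) (pmax _ cr).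
Qed.

(** Strict domination rules out non-candidates. Finiteness matters: if [d * zeta g = N g], every
    joining price yields [-oo] and is a maximizer, candidate or not. *)
Lemma joining_argmax_candidate p : argmax (joining_prices g d) (u_SP g d) p ->
  u_SP g d p != -oo%E -> argmax (candidate_prices g d) (u_SP g d) p.
Proof.
move=> [jp pmax] pNy; split; last by move=> q /candidate_joins; exact: pmax.
case: (joining_dominated jp) => [pE|//|[q /candidate_joins jq pq]].
  by rewrite pE in pNy.
by have := pmax _ jq; rewrite leNgt pq.
Qed.

Lemma SP_valueE p : argmax (joining_prices g d) (u_SP g d) p ->
  SP_value g d = u_SP g d p.
Proof.
move=> [jp pmax]; apply/eqP; rewrite eq_le; apply/andP; split.
  by apply: ge_ereal_sup => _ [q jq <-]; exact: pmax.
by apply: ereal_sup_ubound; exists p.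
Qed.

Lemma SP_no_offerE p : argmax (joining_prices g d) (u_SP g d) p ->
  SP_no_offer g d <-> (u_SP g d p < u_SP0 g)%E.
Proof.
move=> pmax; rewrite /SP_no_offer (SP_valueE pmax); split; last by left.
case=> // -[d0|j0]; first by move: d_gt0; rewrite d0 ltxx.
by case: pmax; rewrite j0.
Qed.

Lemma u_SP0_gtNy : (-oo < u_SP0 g)%E.
Proof.
by rewrite /u_SP0 lne_EFin -?EFinM ?ltNyr// mulr_gt0// divr_gt0.
Qed.

Lemma SP_optimal_joining s : SP_optimal g d s <->
  exists2 p : R, argmax (candidate_prices g d) (u_SP g d) p &
    ((u_SP0 g <= u_SP g d p)%E /\ s = (Some p, true)) \/
    ((u_SP g d p < u_SP0 g)%E /\ s = (None, false)).
Proof.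
split=> [[[no ->]|[no [p pmax ->]]]|[p /argmax_joining pmax]].
(* A best candidate must be exhibited even when no price is quoted; finiteness of the candidate set
   provides one. *)
- have [p pmax] := argmax_candidates; exists p => //; right; split=> //.
  exact/(SP_no_offerE (argmax_joining pmax)).
- have le0p : (u_SP0 g <= u_SP g d p)%E.
    by rewrite leNgt; apply/negP => /(SP_no_offerE pmax).
  exists p; last by left.
  apply: joining_argmax_candidate => //.
  (* An offered price is worth at least [u_SP0 g], which is a real number. *)
  by rewrite gt_eqF// (lt_le_trans u_SP0_gtNy).
- case=> -[up ->]; [right|left]; split=> //.
  + by move/(SP_no_offerE pmax); rewrite ltNge up.
  + by exists p.
  + exact/(SP_no_offerE pmax).
Qed.

End Game.

(** * Demands at which no program is offered *)

Lemma SP_optimal_no_offer (R : realType) (g : params R) (d : R) s :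
  SP_no_offer g d -> SP_optimal g d s <-> s = (None, false).
Proof. by move=> no; split=> [[[]|[]]//|->]; left. Qed.

Lemma joining_prices_set0 (R : realType) (g : params R) (d : R) :
  0 < zeta g -> 0 <= d -> Nhat g / zeta g < d -> joining_prices g d = set0.
Proof.
move=> z0 d0 lt; rewrite -subset0 => p; apply; right; left.
rewrite -subset0 => b [b0 zb bN] /=.
have d_gt0 : 0 < d.
  (* At [d = 0] the quotient [b / d] is 0 by convention, which contradicts [zeta g <= b / d]. *)
  rewrite lt_neqAle d0 andbT; apply/eqP => dE.
  by move: zb; rewrite -dE invr0 mulr0 leNgt z0.
move: zb lt; rewrite ler_pdivlMr// ltr_pdivrMr// mulrC => zb lt.
by have := le_lt_trans (le_trans zb bN) lt; rewrite ltxx.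
Qed.

Unset Implicit Arguments.
Set Strict Implicit.

Theorem theorem2 (R : realType) (g : params R) (d : R)
  (halpha : 0 < alpha g) (hnu1 : 0 < nu1 g) (hnu2 : 0 < nu2 g) (hD : 0 < D g)
  (hkCP : 0 < kCP g) (hkSP : 0 < kSP g) (hzeta : 0 < zeta g)
  (hNhat : 0 < Nhat g) (hN : Nhat g <= N g)
  (hkz : expR 1 < kCP g * zeta g) (hd : 0 <= d) :
  (0 < d <= Nhat g / zeta g ->
     forall s : option R * bool,
       SP_optimal g d s <->
       exists2 p : R, argmax (candidate_prices g d) (u_SP g d) p &
         ((u_SP0 g <= u_SP g d p)%E /\ s = (Some p, true)) \/
         ((u_SP g d p < u_SP0 g)%E /\ s = (None, false)))
  /\
  (Nhat g / zeta g < d \/ d = 0 ->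
     forall s : option R * bool,
       SP_optimal g d s <-> s = (None, false)).
Proof.
split=> [/andP[d0 dN] s|dN s].
  by apply: SP_optimal_joining => //; rewrite -ler_pdivlMr.
apply: SP_optimal_no_offer; right; case: dN => [dN|]; last by left.
by right; exact: joining_prices_set0.
Qed.
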